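(* Let $\lambda>0$ and consider the type II AWGN wiretap channel AWGN-WT($\lambda$) described in the context. Let $\{\mathcal{C}(n)\}$ be a good binary linear code sequence of rate $R_c$ with erasure rate threshold $\delta^{\star}$ for binary erasure channels. Let $\mathcal{C}_0(n)=\{0,1\}^n$ and $\mathcal{C}_1(n)=\mathcal{C}^{\perp}(n)$, the dual code of $\mathcal{C}(n)$. Suppose the secure nested code sequence $\{\mathcal{C}_0(n),\mathcal{C}_1(n)\}$ is used over AWGN-WT($\lambda$). If $$Q(\sqrt{2\lambda})\ge(1-\delta^{\star})/2,$$ where $Q(x)=\int_x^\infty\frac{1}{\sqrt{2\pi}}e^{-z^2/2}\,dz$, then the rate-equivocation pair $(R,R_e)=(R_c,R_c)$ is achievable (i.e., perfect secrecy at rate $R_c$).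
   Context: Type II AWGN wiretap channel AWGN-WT($\lambda$): the transmitter sends a binary sequence $\mathbf{x}\in\{0,1\}^n$ (symbols mapped to $\pm1$); the main channel to the legitimate receiver is noiseless; the eavesdropper channel is memoryless binary-input AWGN with output densities $g(z|X=1)=\frac{1}{\sqrt{2\pi}}\exp[-(z+\sqrt{2\lambda})^2/2]$ and $g(z|X=-1)=\frac{1}{\sqrt{2\pi}}\exp[-(z-\sqrt{2\lambda})^2/2]$. A binary linear code sequence $\{\mathcal{C}(n)\}$ consists of $(n,k_n)$ binary linear codes with common rate $R_c=k_n/n$; it is good if it achieves arbitrarily small word error probability over a noisy channel at nonzero rate. Its erasure rate threshold $\delta^\star$ is the worst-case (largest) erasure probability of a binary erasure channel at which the word error probability (under maximum-likelihood decoding) tends to zero as $n\to\infty$. The dual code is $\mathcal{C}^\perp(n)=\{\mathbf{x}\in\{0,1\}^n:\mathbf{x}\cdot\mathbf{y}=0\ \forall\mathbf{y}\in\mathcal{C}(n)\}$. Secure nested code sequence: $\mathcal{C}_1(n)\subseteq\mathcal{C}_0(n)$ linear codes of rates $R_1\le R_0$; cosets of $\mathcal{C}_1(n)$ in $\mathcal{C}_0(n)$ are indexed by messages $w\in\{1,\dots,M\}$, $M=2^{n(R_0-R_1)}$; a uniform message $W=w$ is encoded by choosing a codeword uniformly at random from the coset $\mathcal{C}_w(n)$; the legitimate receiver recovers $w$ as the coset of the received word. Information rate is $R_0-R_1$. A pair $(R,R_e)$ is achievable if there is a rate-$R$ code sequence with average error probability at the legitimate receiver tending to $0$ and $R_e\le\lim_{n\to\infty}H(W|\mathbf{Z})/n$,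 where $\mathbf{Z}$ is the eavesdropper's output. *)

(* Defs.v *)
From HB Require Import structures.
From mathcomp Require Import all_boot all_order all_algebra.
From mathcomp Require Import all_classical all_reals all_analysis.
Set Implicit Arguments. Unset Strict Implicit. Unset Printing Implicit Defensive.
Import Order.TTheory GRing.Theory Num.Theory.
Import numFieldNormedType.Exports.

Local Open Scope classical_set_scope.
Local Open Scope ring_scope.

Section WT.
Variable R : realType.

Definition bword n := 'rV['F_2]_n.

Definition linear_code n (C : {set bword n}) : bool :=
  (0 \in C) && [forall x in C, forall y in C, x + y \in C].

Definition dual_code n (C : {set bword n}) : {set bword n} :=
  [set x : bword n | [forall y in C, \sum_(i < n) x 0 i * y 0 i == 0]]%SET.

Definition BEC_out n := {ffun 'I_n -> option 'F_2}.

Definition BEC_W (delta : R) n (x : bword n) (y : BEC_out n) : R :=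
  \prod_(i < n) match y i with
                | None => delta
                | Some b => if b == x 0 i then 1 - delta else 0
                end.

(* word error probability of ML (= MAP, uniform codeword) decoding:
   1 - (1/|C|) sum_y max_{x in C} W(y|x)  *)
Definition ML_word_error_BEC (delta : R) n (C : {set bword n}) : R :=
  1 - (#|C|%:R)^-1 * \sum_(y : BEC_out n) \big[Num.max/0]_(x in C) BEC_W delta x y.

Definition BEC_vanishing (N : nat -> nat) (C : forall m, {set bword (N m)})
    (delta : R) : Prop :=
  (fun m => ML_word_error_BEC delta (C m)) @ \oo --> (0 : R).

Definition erasure_threshold (N : nat -> nat) (C : forall m, {set bword (N m)})
    (dstar : R) : Prop :=
  [/\ 0 <= dstar <= 1, BEC_vanishing C dstar &
      forall delta : R, 0 <= delta <= 1 -> BEC_vanishing C delta -> delta <= dstar].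

Definition linear_code_seq (N : nat -> nat) (C : forall m, {set bword (N m)})
    (Rc : R) : Prop :=
  (forall m, (N m < N m.+1)%N) /\
  exists k : nat -> nat, forall m,
    [/\ linear_code (C m), #|C m| = (2 ^ k m)%N & (k m)%:R / (N m)%:R = Rc].

(* good: nonzero rate and arbitrarily small word error probability over a
   noisy channel (here: a binary erasure channel with erasure prob. > 0) *)
Definition good_code_seq (N : nat -> nat) (C : forall m, {set bword (N m)})
    (Rc : R) : Prop :=
  0 < Rc /\ exists delta : R, 0 < delta <= 1 /\ BEC_vanishing C delta.

Definition gauss (mu z : R) : R :=
  (Num.sqrt (2 * pi))^-1 * expR (- ((z - mu) ^+ 2) / 2).

Definition Qfun (x : R) : \bar R :=
  (\int[@lebesgue_measure R]_(z in `[x, +oo[%classic) (gauss 0 z)%:E)%E.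

(* eavesdropper channel AWGN-WT(lambda): bit 0 -> X = +1, bit 1 -> X = -1;
   g(z|X=1) has mean -sqrt(2 lambda), g(z|X=-1) has mean +sqrt(2 lambda) *)
Definition awgn_g (lambda : R) (b : 'F_2) (z : R) : R :=
  if b == 0 then gauss (- Num.sqrt (2 * lambda)) z
  else gauss (Num.sqrt (2 * lambda)) z.

(* iterated Lebesgue integral over R^n; coordinates z 0, ..., z (n-1) *)
Fixpoint intRn (n : nat) (f : (nat -> R) -> \bar R) : \bar R :=
  match n with
  | 0 => f (fun _ => 0)
  | k.+1 => (\int[@lebesgue_measure R]_x
               intRn k (fun v => f (fun i => if i is j.+1 then v j else x)))%E
  end.

Definition log2 (x : R) : R := ln x / ln 2.

(* messages = cosets of C1 in C0 *)
Definition cosets n (C0 C1 : {set bword n}) : {set {set bword n}} :=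
  [set [set x + c | c in C1]%SET | x in C0]%SET.

(* encoder: uniform message w, codeword uniform in coset w *)
Definition enc_prob n (C0 C1 : {set bword n}) (w : {set bword n}) (x : bword n) : R :=
  (#|cosets C0 C1|%:R)^-1 * (if x \in w then (#|w|%:R)^-1 else 0).

(* legitimate receiver (noiseless): decodes the coset of the received word *)
Definition legit_error n (C0 C1 : {set bword n}) : R :=
  \sum_(w in cosets C0 C1) \sum_(x : bword n)
     enc_prob C0 C1 w x * (if [set x + c | c in C1]%SET != w then 1 else 0).

Definition joint_wz (lambda : R) n (C0 C1 : {set bword n}) (w : {set bword n})
    (z : nat -> R) : R :=
  \sum_(x : bword n) enc_prob C0 C1 w x * \prod_(i < n) awgn_g lambda (x 0 i) (z i).

Definition dens_z (lambda : R) n (C0 C1 : {set bword n}) (z : nat -> R) : R :=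
  \sum_(w in cosets C0 C1) joint_wz lambda C0 C1 w z.

Definition equivocation (lambda : R) n (C0 C1 : {set bword n}) : \bar R :=
  intRn n (fun z => (\sum_(w in cosets C0 C1)
     joint_wz lambda C0 C1 w z *
       log2 (dens_z lambda C0 C1 z / joint_wz lambda C0 C1 w z))%:E).

Definition nested_achieves (lambda : R) (N : nat -> nat)
    (C0 C1 : forall m, {set bword (N m)}) (Rr Re : R) : Prop :=
  [/\ forall m, log2 (#|cosets (C0 m) (C1 m)|%:R) / (N m)%:R = Rr,
      (fun m => legit_error (C0 m) (C1 m)) @ \oo --> (0 : R) &
      exists L : \bar R,
        (fun m => (equivocation lambda (C0 m) (C1 m) * ((N m)%:R^-1)%:E)%E)
          @ \oo --> L /\ (Re%:E <= L)%E].

End WT.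

(* Main.v *)
Require Import Defs.
From HB Require Import structures.
From mathcomp Require Import all_boot all_order all_algebra.
From mathcomp Require Import all_classical all_reals all_analysis.
From mathcomp Require Import measurable_realfun lra.
Set Implicit Arguments. Unset Strict Implicit. Unset Printing Implicit Defensive.
Import Order.TTheory GRing.Theory Num.Theory.
Import numFieldNormedType.Exports.
Local Open Scope ring_scope.

(** Each of the two output densities dominates a common function [h] of mass
    [1 - dstar], because their minimum has mass [2 Q(sqrt(2 lambda))]. So the
    eavesdropper's channel is a degraded version of a binary erasure channel
    of erasure probability [1 - dstar], and expanding the product density gives
    a sum over the sets [E] of positions where [z] comes from [h].  When no
    nonzero codeword of [C] vanishes on [E], the dual code projects onto all
    words outside [E], and the corresponding term is the same for every coset.
    The joint density is thus at least a function of [z] alone, and the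
    equivocation is at least [k] times the probability that [E] is of this kind.
    Under erasure probability [dstar], [E] is distributed as the unerased
    positions, and at the other [E] maximum likelihood decoding errs with
    probability at least 1/2; hence that probability tends to 1. *)

(** * Common part of the two Gaussian output densities *)

Section GaussianOverlap.
Local Open Scope classical_set_scope.
Variable R : realType.
Implicit Types s z : R.
Local Notation leb := (@lebesgue_measure R).

Lemma gauss_normal_pdf (m : R) : gauss m = normal_pdf m 1.
Proof.
apply/funext => z; rewrite normal_pdfE ?oner_neq0// /gauss /normal_peak /normal_fun.
by rewrite !expr1n !mul1r mulNr -[pi *+ 2]mulr_natl.
Qed.

Lemma gauss_gt0 (m z : R) : 0 < gauss m z.
Proof. by rewrite mulr_gt0 ?expR_gt0// invr_gt0 sqrtr_gt0 mulr_gt0 ?pi_gt0. Qed.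

Lemma continuous_gauss (m : R) : continuous (gauss m).
Proof. by rewrite gauss_normal_pdf; exact/continuous_normal_pdf/oner_neq0. Qed.

Lemma measurable_gauss (m : R) : measurable_fun [set: R] (gauss m).
Proof. by rewrite gauss_normal_pdf; exact: measurable_normal_pdf. Qed.

Lemma integral_gauss (m : R) : (\int[leb]_z (gauss m z)%:E = 1)%E.
Proof. by rewrite gauss_normal_pdf integral_normal_pdf. Qed.

(* This is the minimum of the two output densities [gauss s] and [gauss (- s)]. *)
Definition overlap s z : R := gauss 0 (`|z| + s).

Lemma overlap_gt0 s z : 0 < overlap s z. Proof. exact: gauss_gt0. Qed.

(** By the triangle inequality [|z - m| <= |z| + s], and a Gaussian density decreases with the
    distance to its mean. *)
Lemma overlap_le_gauss s m z : `|m| <= s -> overlap s z <= gauss m z.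
Proof.
move=> ms; rewrite /overlap /gauss ler_pM2l ?invr_gt0 ?sqrtr_gt0 ?mulr_gt0 ?pi_gt0//.
rewrite ler_expR ler_pM2r ?invr_gt0// lerN2 subr0 -[leLHS]real_normK ?num_real//.
rewrite lerXn2r ?nnegrE// ?addr_ge0//; first exact: le_trans ms.
by rewrite (le_trans (ler_normB _ _))// lerD2l.
Qed.

Lemma measurable_overlap s : measurable_fun [set: R] (overlap s).
Proof.
apply: (measurableT_comp (measurable_gauss 0)).
by apply: measurable_funD => //; exact: normr_measurable.
Qed.

Lemma integral_gauss_shift s :
  (\int[leb]_(z in `[0%R, +oo[) (gauss 0 (z + s))%:E = Qfun s)%E.
Proof.
have dF : derive1 (fun z : R => z + s) = cst 1.
  by apply/funext => z; rewrite derive1E deriveD// derive_id derive_cst addr0.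
rewrite /Qfun -[s in RHS]add0r.
rewrite (@increasing_ge0_integration_by_substitutiony R (fun z => z + s) (gauss 0) 0)//=.
- by apply: eq_integral => z _; rewrite dF /= mulr1.
- by move=> x y _ _; rewrite ltrD2r.
- by rewrite dF => ? _; exact: cst_continuous.
- by rewrite dF; exact: is_cvg_cst.
- by rewrite dF; exact: is_cvg_cst.
- split; first by move=> x _; exact: derivableD.
  by apply: cvg_at_right_filter; apply: cvgD; [exact: cvg_id|exact: cvg_cst].
- exact: cvg_addrr.
- exact/continuous_subspaceT/continuous_gauss.
- by move=> x _; exact/ltW/gauss_gt0.
Qed.

(** The overlap is even, and on the right half-line it is the standard Gaussian shifted by [s]. *)
Lemma integral_overlap s :
  (\int[leb]_z (overlap s z)%:E = Qfun s + Qfun s)%E.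
Proof.
have mo : measurable_fun [set: R] (fun z => (overlap s z)%:E).
  by apply/measurable_EFinP; exact: measurable_overlap.
have o0 z : (0 <= (overlap s z)%:E)%E by rewrite lee_fin ltW ?overlap_gt0.
have right : (\int[leb]_(z in `[0%R, +oo[) (overlap s z)%:E = Qfun s)%E.
  rewrite -integral_gauss_shift; apply: eq_integral => z.
  by rewrite inE/= in_itv/= andbT /overlap => z0; rewrite ger0_norm.
have -> : [set: R] = `]-oo, 0%R[ `|` `[0%R, +oo[.
  by rewrite -setCitvl setUv.
rewrite ge0_integral_setU//=; last 2 first.
  exact: measurable_funTS.
  by rewrite -setCitvl; apply/disj_set2P; rewrite setICr.
congr (_ + _)%E; rewrite // integral_itv_bndo_bndc; last exact: measurable_funTS.
rewrite -right ge0_integration_by_substitution0//.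
by apply: eq_integral => z _; rewrite /overlap normrN.
Qed.

(** Scaling the overlap down by [eta / (2 * Qfun s)] gives mass exactly [eta], so that what is left
    of either density later has mass exactly [1 - eta]. *)
Lemma minorant_of_overlap s (eta : R) : 0 <= s -> 0 <= eta ->
    ((eta / 2)%:E <= Qfun s)%E ->
  exists h : R -> R, [/\ measurable_fun [set: R] h, forall z, 0 <= h z,
    forall m z, `|m| <= s -> h z <= gauss m z &
    (\int[leb]_z (h z)%:E = eta%:E)%E].
Proof.
move=> s0 eta0 hQ.
have mo : measurable_fun [set: R] (fun z => (overlap s z)%:E).
  by apply/measurable_EFinP; exact: measurable_overlap.
have o0 z : (0 <= (overlap s z)%:E)%E by rewrite lee_fin ltW ?overlap_gt0.
have intQ := integral_overlap s.
(* This bound excludes an infinite [Qfun s]. *)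
have le1 : (Qfun s + Qfun s <= 1)%E.
  rewrite -intQ -(integral_gauss 0); apply: ge0_le_integral => //.
    by apply/measurable_EFinP; exact: measurable_gauss.
  by move=> z _; rewrite lee_fin overlap_le_gauss// normr0.
have Q0 : (0 <= Qfun s)%E.
  by apply: integral_ge0 => z _; rewrite lee_fin ltW ?gauss_gt0.
move: hQ le1 Q0 intQ; case: (Qfun s) => [q| |]//.
rewrite -EFinD !lee_fin => hq q1 q0 intQ.
have etaq : eta <= q + q by lra.
exists (fun z => eta / (q + q) * overlap s z).
have c0 : 0 <= eta / (q + q) by rewrite divr_ge0// addr_ge0.
split.
- by apply: measurable_funM => //; exact: measurable_overlap.
- by move=> z; rewrite mulr_ge0// ltW ?overlap_gt0.
- move=> m z ms; apply: le_trans (overlap_le_gauss z ms).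
  apply: ler_piMl; first exact/ltW/overlap_gt0.
  (* For [q = 0] the quotient is 0 by convention; then [eta] vanishes too, so the mass computed
     below is still [eta]. *)
  have [->|qN0] := eqVneq (q + q) 0; first by rewrite invr0 mulr0.
  by rewrite ler_pdivrMr ?mul1r// lt_neqAle eq_sym qN0 addr_ge0.
- under eq_integral do rewrite EFinM.
  rewrite ge0_integralZl_EFin// intQ -EFinM.
  have [qq|qN0] := eqVneq (q + q) 0; last by rewrite divfK.
  by congr EFin; rewrite qq mulr0; lra.
Qed.

End GaussianOverlap.

(** * Iterated integrals of nonnegative functions *)

Section IteratedIntegral.
Local Open Scope classical_set_scope.
Variable R : realType.
Local Notation leb := (@lebesgue_measure R).

(** A nonnegative integral is a supremum over the simple functions below the integrand, so the
    comparison applies directly to the entropy integrand. *)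
Lemma le_integralT (f g : R -> \bar R) :
  (forall x, 0 <= f x)%E -> (forall x, f x <= g x)%E ->
  (\int[leb]_x f x <= \int[leb]_x g x)%E.
Proof.
move=> f0 fg; have g0 x : (0 <= g x)%E := le_trans (f0 x) (fg x).
rewrite !ge0_integralTE//; apply: le_ereal_sup => _ [h hf <-].
by exists h => //= x; exact: le_trans (fg x).
Qed.

Lemma intRn_ge0 n (f : (nat -> R) -> \bar R) :
  (forall z, 0 <= f z)%E -> (0 <= intRn n f)%E.
Proof.
elim: n f => [|n IH] f f0 /=; first exact: f0.
by apply: integral_ge0 => x _; apply: IH => v; exact: f0.
Qed.

Lemma le_intRn n (f g : (nat -> R) -> \bar R) :
  (forall z, 0 <= f z)%E -> (forall z, f z <= g z)%E ->
  (intRn n f <= intRn n g)%E.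
Proof.
elim: n f g => [|n IH] f g f0 fg /=; first exact: fg.
apply: le_integralT => x; first by apply: intRn_ge0 => v; exact: f0.
by apply: IH => v.
Qed.

(** Both bounds on the equivocation compare its integrand with a finite sum of products, the only
    integrand that has to be evaluated. *)
Lemma intRn_sum_prod n (J : finType) (a : J -> R) (F : J -> 'I_n -> R -> R)
    (c : J -> 'I_n -> R) :
  (forall j, 0 <= a j) -> (forall j i z, 0 <= F j i z) ->
  (forall j i, measurable_fun [set: R] (F j i)) ->
  (forall j i, \int[leb]_z (F j i z)%:E = (c j i)%:E)%E ->
  intRn n (fun z => (\sum_j a j * \prod_(i < n) F j i (z i))%:E) =
  (\sum_j a j * \prod_(i < n) c j i)%:E.
Proof.
elim: n a F c => [|n IH] a F c a0 F0 mF IF /=.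
  by congr EFin; apply: eq_bigr => j _; rewrite !big_ord0.
have c0 j i : 0 <= c j i.
  by rewrite -lee_fin -IF; apply: integral_ge0 => z _; rewrite lee_fin.
pose b j := \prod_(i < n) c j (lift ord0 i).
have b0 j : 0 <= b j by apply: prodr_ge0.
transitivity (\int[leb]_x (\sum_j (a j * b j)%:E * (F j ord0 x)%:E))%E.
  apply: eq_integral => x _.
  (* The factor at the outer coordinate is absorbed into the coefficients, so that the induction
     hypothesis applies. *)
  transitivity (intRn n (fun v =>
      (\sum_j (a j * F j ord0 x) * \prod_(i < n) F j (lift ord0 i) (v i))%:E)).
    congr intRn; apply/funext => v; congr EFin; apply: eq_bigr => j _.
    by rewrite big_ord_recl mulrA.
  rewrite (IH _ (fun j i => F j (lift ord0 i)) (fun j i => c j (lift ord0 i)))//; last first.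
    by move=> j; rewrite mulr_ge0.
  by rewrite -sumEFin; apply: eq_bigr => j _; rewrite -EFinM mulrAC.
rewrite ge0_integral_sum//; first last.
- by move=> j x _; rewrite -EFinM lee_fin !mulr_ge0.
- move=> j; apply/measurable_EFinP; apply: measurable_funM => //.
  exact: mF.
rewrite -sumEFin; apply: eq_bigr => j _.
rewrite ge0_integralZl_EFin//; first last.
- by rewrite mulr_ge0.
- by apply/measurable_EFinP; exact: mF.
- by move=> x _; rewrite lee_fin.
by rewrite IF -EFinM big_ord_recl -mulrA [_ * b j]mulrC.
Qed.

End IteratedIntegral.

(** * Binary linear codes, their duals and cosets *)

Section BinaryCodes.
Variable n : nat.
Implicit Types (C : {set bword n}) (E : {set 'I_n}) (x y : bword n).

Definition dotp x y : 'F_2 := \sum_(i < n) x 0 i * y 0 i.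

Lemma dotpDl x1 x2 y : dotp (x1 + x2) y = dotp x1 y + dotp x2 y.
Proof. by rewrite -big_split; apply: eq_bigr => i _; rewrite mxE mulrDl. Qed.

Lemma dotpDr x y1 y2 : dotp x (y1 + y2) = dotp x y1 + dotp x y2.
Proof. by rewrite -big_split; apply: eq_bigr => i _; rewrite mxE mulrDr. Qed.

Lemma dotp0r x : dotp x 0 = 0.
Proof. by apply: big1 => i _; rewrite mxE mulr0. Qed.

Lemma dotp_delta i y : dotp (delta_mx 0 i) y = y 0 i.
Proof.
rewrite /dotp (bigD1 i)//= mxE !eqxx mul1r big1 ?addr0// => j ji.
by rewrite mxE (negPf ji) mul0r.
Qed.

Lemma dual_codeP C x :
  reflect (forall c, c \in C -> dotp x c = 0) (x \in dual_code C).
Proof. by rewrite inE; apply: (iffP forall_inP) => h c /h /eqP. Qed.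

Lemma dual_code_linear C : linear_code (dual_code C).
Proof.
apply/andP; split.
  by apply/dual_codeP => c _; rewrite /dotp big1// => i _; rewrite mxE mul0r.
apply/forall_inP => x /dual_codeP hx; apply/forall_inP => y /dual_codeP hy.
by apply/dual_codeP => c cC; rewrite dotpDl hx// hy// addr0.
Qed.

Lemma bword_addKr x y : y + x + x = y.
Proof.
rewrite -addrA (_ : x + x = 0) ?addr0//.
by apply/rowP => i; rewrite !mxE; case: (x 0 i) => [[|[|]]]//= ?; exact/val_inj.
Qed.

Lemma mem_linear_codeDr C x y : linear_code C -> x \in C ->
  (y + x \in C) = (y \in C).
Proof.
move=> /andP[_ /forall_inP CD] xC.
have add a b : a \in C -> b \in C -> a + b \in C.
  by move=> aC bC; exact: (forall_inP (CD a aC)).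
by apply/idP/idP => yC; [rewrite -(bword_addKr x y)|]; exact: add.
Qed.

Lemma linear_code0 C : linear_code C -> 0 \in C.
Proof. by case/andP. Qed.

Lemma linear_code_card_gt0 C : linear_code C -> (0 < #|C|)%N.
Proof. by move=> lC; apply/card_gt0P; exists 0; exact: linear_code0. Qed.

(** For linear [C] this is injectivity of the restriction to [E]: a codeword received only on [E] is
    determined. *)
Definition separates C E :=
  [forall c in C, [forall i in E, c 0 i == 0] ==> (c == 0)].

Lemma separatesPn C E :
  reflect (exists c, [/\ c \in C, c != 0 & forall i, i \in E -> c 0 i = 0])
          (~~ separates C E).
Proof.
apply: (iffP forall_inPn) => [[c cC]|[c [cC c0 cE]]].
  by rewrite negb_imply => /andP[/forall_inP cE c0]; exists c; split=> // i /cE/eqP.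
by exists c => //; rewrite negb_imply c0 andbT; apply/forall_inP => i /cE ->.
Qed.

Lemma separates_setT C : separates C [set: 'I_n]%SET.
Proof.
apply/negPn/negP => /separatesPn[c [_ /eqP c0 cE]].
by apply: c0; apply/rowP => i; rewrite cE ?inE// mxE.
Qed.

Section Characters.
Variable R : numDomainType.

(** The nontrivial additive character of the field with two elements. *)
Definition chi2 (b : 'F_2) : R := if b == 0 then 1 else -1.

Lemma chi2D a b : chi2 (a + b) = chi2 a * chi2 b.
Proof.
rewrite /chi2; case: a b => [[|[|]]]//= ? [[|[|]]]//= ?;
by rewrite !(mulr1, mul1r, mulrNN).
Qed.

(** Off the dual some codeword [c0] has [dotp y c0 != 0]; translating by [c0] turns the sum into its
    opposite. *)
Lemma sum_chi2_dotp C y : linear_code C ->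
  \sum_(c in C) chi2 (dotp y c) = if y \in dual_code C then #|C|%:R else 0.
Proof.
move=> lC; case: ifPn => [/dual_codeP yD|yD].
  under eq_bigr => c cC do rewrite yD// /chi2 eqxx.
  by rewrite sumr_const.
move: yD; rewrite inE => /forall_inPn[c0 c0C yc0].
apply/eqP; rewrite -eqNr -sumrN; apply/eqP; rewrite [RHS](reindex_inj (addIr c0))/=.
rewrite [RHS](eq_bigl (mem C)) => [|c]; last exact: mem_linear_codeDr.
apply: eq_bigr => c _.
rewrite dotpDr chi2D [chi2 (dotp y c0)]/chi2 [dotp y c0 == 0](negPf yc0).
by rewrite mulrN1.
Qed.

(* Expanding the indicator of the dual code in characters leaves only the
   trivial one: any other codeword has a nonzero coordinate in [E], on which
   [phi] does not depend. *)
Lemma sum_dual_coset C E (phi : bword n -> R) (u : bword n) :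
  linear_code C -> separates C E ->
  (forall x y, (forall i, i \notin E -> x 0 i = y 0 i) -> phi x = phi y) ->
  #|C|%:R * (\sum_(d in dual_code C) phi (u + d)) = \sum_x phi x.
Proof.
move=> lC sC phiE.
transitivity (\sum_c \sum_(y : bword n)
    (if c \in C then chi2 (dotp y c) else 0) * phi (u + y)).
  rewrite exchange_big/= mulr_sumr [RHS](bigID (mem (dual_code C)))/=.
  rewrite [X in _ + X]big1 ?addr0 => [|y yD]; last first.
    by rewrite -mulr_suml -big_mkcond/= sum_chi2_dotp// (negPf yD) mul0r.
  apply: eq_bigr => y yD.
  by rewrite -mulr_suml -big_mkcond/= sum_chi2_dotp// yD.
rewrite (bigD1 0)//= linear_code0// [X in _ + X]big1 ?addr0 => [|c c0].
  rewrite [RHS](reindex_inj (addrI u))/=; apply: eq_bigr => y _.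
  by rewrite dotp0r /chi2 eqxx mul1r.
have [cC|] := boolP (c \in C); last by under eq_bigr do rewrite mul0r; rewrite big1.
have [i iE ci] : exists2 i, i \in E & c 0 i != 0.
  apply/exists_inP; move: c0; apply: contraR => h.
  move/forall_inP: sC => /(_ c cC)/implyP; apply; apply/forall_inP => i iE.
  by apply: contraR h => ci; apply/exists_inP; exists i.
apply/eqP; rewrite -eqNr -sumrN; apply/eqP.
rewrite [RHS](reindex_inj (addIr (delta_mx 0 i)))/=.
apply: eq_bigr => y _.
rewrite dotpDl chi2D dotp_delta [chi2 (c 0 i)]/chi2 (negPf ci) mulrN1 mulNr.
congr (- (_ * _)); apply: phiE => j jE; rewrite !mxE.
by rewrite (_ : j == i = false) ?andbF ?addr0//; apply: contraNF jE => /eqP ->.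
Qed.

End Characters.

(** This is [sum_dual_coset] for the constant function 1, with all positions as separating set. *)
Lemma card_code_dual C : linear_code C -> (#|C| * #|dual_code C| = 2 ^ n)%N.
Proof.
move=> lC; have := @sum_dual_coset rat C _ (fun=> 1) 0 lC (separates_setT C).
rewrite !sumr_const -natrM => /(_ (fun _ _ _ => erefl))/eqP.
by rewrite eqr_nat card_mx card_Fp// mul1n => /eqP.
Qed.

Definition coset_of_word (D : {set bword n}) x : {set bword n} :=
  [set x + c | c in D]%SET.

Section Cosets.
Variable D : {set bword n}.
Hypothesis lD : linear_code D.

Lemma mem_coset_of_word x y : (x \in coset_of_word D y) = (y + x \in D).
Proof.
apply/imsetP/idP => [[d dD ->]|yx].
  by rewrite addrC [y + d]addrC bword_addKr.
by exists (y + x) => //; rewrite addrC [y + x]addrC bword_addKr.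
Qed.

Lemma eq_coset_of_word x y :
  (coset_of_word D x == coset_of_word D y) = (x \in coset_of_word D y).
Proof.
apply/eqP/idP => [<-|].
  by rewrite mem_coset_of_word -[x + x]add0r addrA bword_addKr linear_code0.
rewrite mem_coset_of_word => yx; apply/setP => z; rewrite !mem_coset_of_word.
rewrite -(mem_linear_codeDr (x + z) lD yx).
by rewrite [x + z]addrC addrACA addrA bword_addKr addrC.
Qed.

Lemma card_coset_of_word x : #|coset_of_word D x| = #|D|.
Proof. by rewrite card_imset//; exact: addrI. Qed.

Lemma sum_cosets (V : nmodType) (F : {set bword n} -> bword n -> V) :
  \sum_(w in cosets [set: bword n] D) \sum_(x in w) F w x =
  \sum_x F (coset_of_word D x) x.
Proof.
rewrite [RHS](partition_big_imset (coset_of_word D))/=.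
have -> : cosets [set: bword n] D = [set coset_of_word D x | x : bword n]%SET.
  by apply/setP => w; apply/imsetP/imsetP => -[x _ ->]; exists x.
apply: eq_bigr => _ /imsetP[y _ ->].
rewrite (eq_bigl (fun x => coset_of_word D x == coset_of_word D y)).
  by apply: eq_bigr => x /eqP ->.
by move=> x; rewrite eq_coset_of_word.
Qed.

Lemma card_cosets : (#|cosets [set: bword n] D| * #|D| = 2 ^ n)%N.
Proof.
have := sum_cosets (fun _ _ => 1%N).
rewrite [RHS]sum1_card card_mx /= card_Fp// mul1n => <-.
rewrite -sum_nat_const; apply: eq_bigr => _ /imsetP[x _ ->].
by rewrite sum1_card card_coset_of_word.
Qed.

End Cosets.

(** Both cardinalities times that of the dual give [2 ^ n]. Hence the information rate is the rate
    of [C]. *)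
Lemma card_cosets_dual C : linear_code C ->
  #|cosets [set: bword n] (dual_code C)| = #|C|.
Proof.
move=> lC; apply/eqP; rewrite -(@eqn_pmul2r #|dual_code C|).
  by rewrite card_cosets ?dual_code_linear// card_code_dual.
exact/linear_code_card_gt0/dual_code_linear.
Qed.

(** Each summand vanishes: a word in the coset is decoded to it, and any other word is never sent
    for it. *)
Lemma legit_error_full (R : realType) (D : {set bword n}) : linear_code D ->
  legit_error R [set: bword n] D = 0.
Proof.
move=> lD; apply: big1 => _ /imsetP[y _ ->]; apply: big1 => x _.
rewrite /enc_prob -!/(coset_of_word D _) eq_coset_of_word//.
by case: ifP; rewrite ?mulr0 ?mul0r.
Qed.

End BinaryCodes.

(** * Erasure patterns and maximum likelihood decoding *)

Section ErasureChannel.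
Variables (R : realType) (n : nat).
Implicit Types (C : {set bword n}) (E : {set 'I_n}) (x : bword n).
Implicit Types (y : BEC_out n) (delta : R).

Definition unerased y : {set 'I_n} := [set i | y i != None]%SET.

Definition unerased_prob delta E : R :=
  \prod_(i < n) if i \in E then 1 - delta else delta.

Definition separating_prob delta C : R :=
  \sum_(E | separates C E) unerased_prob delta E.

Lemma sum_unerased_prob delta : \sum_E unerased_prob delta E = 1.
Proof. by rewrite -bigA_distr big1// => i _ /=; rewrite subrK. Qed.

Lemma BEC_W_ge0 delta x y : 0 <= delta <= 1 -> 0 <= BEC_W delta x y.
Proof.
move=> /andP[d0 d1]; apply: prodr_ge0 => i _; case: (y i) => // b.
by case: ifP; rewrite ?subr_ge0.
Qed.

(** Among the outputs with unerased set [E], only the one agreeing with [x] on [E] can have nonzero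
    likelihood. So the law of the unerased set does not depend on [x]. *)
Lemma sum_BEC_W delta x (P : pred {set 'I_n}) :
  \sum_(y | P (unerased y)) BEC_W delta x y = \sum_(E | P E) unerased_prob delta E.
Proof.
rewrite (partition_big unerased P)//=; apply: eq_bigr => E PE.
pose yE : BEC_out n := [ffun i => if i \in E then Some (x 0 i) else None].
have uE : unerased yE = E.
  by apply/setP => i; rewrite inE ffunE; case: (i \in E).
rewrite (bigD1 yE) ?uE ?PE ?eqxx//= [X in _ + X]big1 ?addr0 => [|y].
  by apply: eq_bigr => i _; rewrite ffunE; case: (i \in E); rewrite ?eqxx.
move=> /andP[/andP[_ /eqP uy] yyE].
have [i yi] : exists i, y i != yE i.
  apply/existsP; apply: contraR yyE => /existsPn h.
  by apply/eqP/ffunP => i; apply/eqP; have := h i; rewrite negbK.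
rewrite /BEC_W (bigD1 i)//=; move: yi; rewrite ffunE -uy inE.
case: (y i) => [b|]//=; have [->|bx _] := eqVneq b (x 0 i); first by rewrite eqxx.
by rewrite mul0r.
Qed.

Lemma BEC_W_shift delta x (c : bword n) y :
  (forall i, i \in unerased y -> c 0 i = 0) ->
  BEC_W delta (x + c) y = BEC_W delta x y.
Proof.
move=> cy; apply: eq_bigr => i _.
case yi: (y i) => [b|]//; by rewrite mxE cy ?addr0// inE yi.
Qed.

(* If the unerased positions do not separate the code, some nonzero codeword
   vanishes there and every likelihood is attained at least twice. *)
Lemma bigmax_BEC_W_le delta C y : linear_code C -> 0 <= delta <= 1 ->
  \big[Num.max/0]_(x in C) BEC_W delta x y <=
  (if separates C (unerased y) then 1 else 2^-1) * \sum_(x in C) BEC_W delta x y.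
Proof.
move=> lC d01; have W0 x := BEC_W_ge0 x y d01.
have S0 : 0 <= \sum_(x in C) BEC_W delta x y by exact: sumr_ge0.
apply/bigmax_leP; split; first by rewrite mulr_ge0//; case: ifP.
move=> x xC; case: ifPn => [_|/separatesPn[c [cC c0 cy]]].
  by rewrite mul1r (bigD1 x)//= lerDl sumr_ge0.
have xcx : x + c != x by rewrite -subr_eq0 addrAC subrr add0r.
rewrite mulrC ler_pdivlMr// (bigD1 x)//= (bigD1 (x + c))/=; last first.
  by rewrite xcx andbT addrC mem_linear_codeDr.
by rewrite BEC_W_shift// addrA -mulr2n mulr_natr lerDl sumr_ge0.
Qed.

(** Summing [bigmax_BEC_W_le] over the outputs bounds the probability of correct decoding by
    [p + (1 - p) / 2], with [p] the separating probability. *)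
Lemma separating_prob_ge delta C : linear_code C -> 0 <= delta <= 1 ->
  1 - 2 * ML_word_error_BEC delta C <= separating_prob delta C.
Proof.
move=> lC d01.
have C0 : (0 : R) < #|C|%:R.
  by rewrite ltr0n linear_code_card_gt0.
pose p := separating_prob delta C.
have sumW (x : bword n) :
    \sum_y (if separates C (unerased y) then 1 else 2^-1) * BEC_W delta x y =
    p + 2^-1 * (1 - p).
  rewrite (bigID (fun y => separates C (unerased y)))/=; congr (_ + _).
    rewrite /p /separating_prob -(sum_BEC_W delta x).
    by apply: eq_bigr => y ->; exact: mul1r.
  rewrite -(sum_unerased_prob delta) [X in _ * (X - _)](bigID (separates C))/=.
  rewrite addrAC subrr add0r -(sum_BEC_W _ x (fun E => ~~ separates C E)) mulr_sumr.
  by apply: eq_bigr => y /negPf ->.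
suff : (#|C|%:R)^-1 * (\sum_y \big[Num.max/0]_(x in C) BEC_W delta x y) <=
       p + 2^-1 * (1 - p).
  by rewrite /ML_word_error_BEC -/p; set t := _ * _; lra.
rewrite mulrC ler_pdivrMr//.
apply: (@le_trans _ _ (\sum_(x in C) (p + 2^-1 * (1 - p)))); last first.
  by rewrite sumr_const mulr_natr.
under [leRHS]eq_bigr => x _ do rewrite -(sumW x).
rewrite exchange_big/=; apply: ler_sum => y _.
by rewrite -mulr_sumr bigmax_BEC_W_le.
Qed.

End ErasureChannel.

(** * Entropy bounds for finite positive weights *)

Section Entropy.
Variables (R : realType) (I : finType) (A : {set I}) (p : I -> R).
Hypothesis p_gt0 : forall i, i \in A -> 0 < p i.
Local Notation P := (\sum_(i in A) p i).

Lemma ln_le_subr1 (x : R) : 0 < x -> ln x <= x - 1.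
Proof.
by move=> x0; rewrite -[x in ln x](subrK 1) addrC le_ln1Dx// ltrBrDr addNr.
Qed.

Lemma log2_ge0 (x : R) : 1 <= x -> 0 <= log2 x.
Proof. by move=> x1; rewrite divr_ge0// ln_ge0// ler1n. Qed.

Lemma log2_ratio_ge0 i : i \in A -> 0 <= log2 (P / p i).
Proof.
move=> iA; rewrite log2_ge0// ler_pdivlMr ?p_gt0// mul1r (bigD1 i)//= lerDl.
by apply: sumr_ge0 => j /andP[jA _]; exact/ltW/p_gt0.
Qed.

Lemma entropy_ge0 : 0 <= \sum_(i in A) p i * log2 (P / p i).
Proof.
apply: sumr_ge0 => i iA; apply: mulr_ge0; first exact/ltW/p_gt0.
exact: log2_ratio_ge0.
Qed.

Lemma sum_gt0 : (0 < #|A|)%N -> 0 < P.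
Proof.
case/card_gt0P => i iA; rewrite (bigD1 i)//= ltr_wpDr ?p_gt0//.
by apply: sumr_ge0 => j /andP[jA _]; exact/ltW/p_gt0.
Qed.

(** Apply [ln x <= x - 1] to [x = P / p i / #|A|]; the weighted right sides sum to zero. The weights
    are not normalised because they will be joint densities at a fixed output [z]. *)
Lemma entropy_le : (0 < #|A|)%N ->
  \sum_(i in A) p i * log2 (P / p i) <= P * log2 #|A|%:R.
Proof.
move=> A0; have M0 : (0 : R) < #|A|%:R by rewrite ltr0n.
have P0 := sum_gt0 A0.
have ln2 : 0 < ln (2 : R) by rewrite ln_gt0// ltr1n.
rewrite /log2 mulrA ler_pdivlMr// mulr_suml.
under eq_bigr do rewrite mulrA divfK ?gt_eqF//.
rewrite -subr_le0 mulr_suml -sumrB.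
apply: (@le_trans _ _ (\sum_(i in A) (P / #|A|%:R - p i))).
  apply: ler_sum => i /p_gt0 pi0; rewrite -mulrBr -ln_div ?posrE ?divr_gt0//.
  have x0 : 0 < P / p i / #|A|%:R by rewrite !divr_gt0.
  apply: le_trans (ler_wpM2l (ltW pi0) (ln_le_subr1 x0)) _.
  rewrite mulrBr mulr1 lerD2r mulrA [p i * _]mulrC divfK ?gt_eqF//.
by rewrite sumrB sumr_const -[X in X - _]mulr_natr divfK ?subrr// gt_eqF.
Qed.

(* The part of the entropy above the common lower bound [c] is dropped, which
   is harmless since [P >= p i]; AM-GM bounds the rest. *)
Lemma entropy_ge (c : R) : (0 < #|A|)%N -> 0 <= c -> (forall i, i \in A -> c <= p i) ->
  #|A|%:R * c * log2 #|A|%:R <= \sum_(i in A) p i * log2 (P / p i).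
Proof.
move=> A0 c0 cp; have M0 : (0 : R) < #|A|%:R by rewrite ltr0n.
have P0 := sum_gt0 A0.
have ln2 : 0 < ln (2 : R) by rewrite ln_gt0// ltr1n.
apply: (@le_trans _ _ (\sum_(i in A) c * log2 (P / p i))); last first.
  by apply: ler_sum => i iA; rewrite ler_wpM2r ?cp// log2_ratio_ge0.
rewrite -mulr_sumr -mulrA mulrCA ler_wpM2l// /log2 -mulr_suml mulrA ler_wpM2r//.
  by rewrite invr_ge0 ltW.
rewrite -subr_ge0 -oppr_le0 opprB.
rewrite mulrC mulr_natr -sumr_const -sumrB.
apply: (@le_trans _ _ (\sum_(i in A) (#|A|%:R * p i / P - 1))).
  apply: ler_sum => i /p_gt0 pi0; rewrite -ln_div ?posrE ?divr_gt0// invf_div mulrA.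
  by apply: ln_le_subr1; rewrite divr_gt0// mulr_gt0.
by rewrite sumrB -mulr_suml -mulr_sumr mulfK ?gt_eqF// sumr_const subrr.
Qed.

End Entropy.

(** * Two-sided bounds on the equivocation of one code *)

Section Equivocation.
Variables (R : realType) (lambda : R) (n : nat) (C : {set bword n}).
Hypothesis lC : linear_code C.
Local Notation D := (dual_code C).
Local Notation C0 := [set: bword n]%SET.
Local Notation s := (Num.sqrt (2 * lambda)).
Local Notation leb := (@lebesgue_measure R).
Implicit Types (z : nat -> R) (x : bword n) (E : {set 'I_n}).

Lemma awgn_gE b : awgn_g lambda b = gauss (if b == 0 then - s else s).
Proof. by apply/funext => t; rewrite /awgn_g; case: ifP. Qed.

Let pw (u : bword n) z := \prod_(i < n) awgn_g lambda (u 0 i) (z i).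

Lemma pw_gt0 u z : 0 < pw u z.
Proof. by apply: prodr_gt0 => i _; rewrite awgn_gE gauss_gt0. Qed.

(** The weights of message and codeword multiply to [1 / (#|C| * #|D|)]: the transmitted word is
    uniform over all words. *)
Lemma joint_wzE u z : joint_wz lambda C0 D (coset_of_word D u) z =
  (2 ^+ n)^-1 * \sum_(d in D) pw (u + d) z.
Proof.
rewrite /joint_wz /enc_prob card_coset_of_word card_cosets_dual//.
rewrite -natrX -(card_code_dual lC) natrM invfM mulr_sumr.
have <- : \sum_(x in coset_of_word D u) #|C|%:R^-1 / #|D|%:R * pw x z =
    \sum_(d in D) #|C|%:R^-1 / #|D|%:R * pw (u + d) z.
  by rewrite big_imset//= => d e _ _ /addrI.
rewrite [RHS]big_mkcond/=; apply: eq_bigr => x _.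
by rewrite /coset_of_word; case: ifP; rewrite ?mulr0 ?mul0r.
Qed.

Lemma joint_wz_gt0 w z : w \in cosets C0 D -> 0 < joint_wz lambda C0 D w z.
Proof.
case/imsetP => u _ ->; rewrite joint_wzE mulr_gt0 ?invr_gt0 ?exprn_gt0//.
case/card_gt0P: (linear_code_card_gt0 (dual_code_linear C)) => d dD.
rewrite (bigD1 d)//= ltr_wpDr ?pw_gt0//.
by apply: sumr_ge0 => e _; exact/ltW/pw_gt0.
Qed.

Lemma dens_zE z : dens_z lambda C0 D z = \sum_x (2 ^+ n)^-1 * pw x z.
Proof.
rewrite /dens_z -(sum_cosets (dual_code_linear C) (fun _ x => (2 ^+ n)^-1 * pw x z)).
apply: eq_bigr => _ /imsetP[u _ ->]; rewrite -/(coset_of_word D u) joint_wzE.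
by rewrite mulr_sumr big_imset//= => d e _ _ /addrI.
Qed.

Let card_cosets_gt0 : (0 < #|cosets C0 D|)%N.
Proof. by rewrite card_cosets_dual// linear_code_card_gt0. Qed.

Let entropy0 z : (0 <= (\sum_(w in cosets C0 D) joint_wz lambda C0 D w z *
   log2 (dens_z lambda C0 D z / joint_wz lambda C0 D w z))%:E)%E.
Proof. by rewrite lee_fin entropy_ge0// => w wD; exact: joint_wz_gt0. Qed.

(** [entropy_le] at each [z] leaves the output density times a constant, and that density has mass
    1. *)
Lemma equivocation_le : (equivocation lambda C0 D <= (log2 #|C|%:R)%:E)%E.
Proof.
apply: (@le_trans _ _ (intRn n (fun z =>
    (\sum_(x : bword n) (2 ^+ n)^-1 * log2 #|C|%:R *
      \prod_(i < n) awgn_g lambda (x 0 i) (z i))%:E))).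
  apply: le_intRn => z //; rewrite lee_fin.
  apply: le_trans (entropy_le (fun w => joint_wz_gt0 z (w := w)) card_cosets_gt0) _.
  rewrite card_cosets_dual// -/(dens_z _ _ _ _) dens_zE mulr_suml.
  by apply: ler_sum => x _; rewrite mulrAC.
rewrite (intRn_sum_prod (F := fun x i => awgn_g lambda (x 0 i)) (c := fun _ _ => 1)).
- under eq_bigr do rewrite big1 ?mulr1//.
  rewrite sumr_const card_mx card_Fp// mul1n -[X in X%:E]mulr_natr natrX.
  by rewrite mulrAC mulVf ?mul1r// expf_neq0// pnatr_eq0.
- by move=> x; rewrite mulr_ge0 ?invr_ge0 ?exprn_ge0// log2_ge0// ler1n linear_code_card_gt0.
- by move=> x i t; rewrite awgn_gE ltW ?gauss_gt0.
- by move=> x i; rewrite awgn_gE; exact: measurable_gauss.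
- by move=> x i; rewrite awgn_gE integral_gauss.
Qed.

Section LowerBound.
Variables (delta : R) (h : R -> R).
Hypothesis h0 : forall t, 0 <= h t.
Hypothesis mh : measurable_fun setT h.
Hypothesis hg : forall b t, h t <= awgn_g lambda b t.
Hypothesis ih : (\int[leb]_t (h t)%:E = (1 - delta)%:E)%E.

(* The channel law splits as [h + (g_b - h)]; a position in [E] sees only the
   part [h] that carries no information on the bit. *)
Let piece E x (i : 'I_n) (t : R) : R :=
  if i \in E then h t else awgn_g lambda (x 0 i) t - h t.

Let piece_ge0 E x i t : 0 <= piece E x i t.
Proof. by rewrite /piece; case: ifP; rewrite ?subr_ge0. Qed.

Let measurable_piece E x i : measurable_fun setT (piece E x i).
Proof.
rewrite /piece; case: (i \in E) => //; apply: measurable_funB => //.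
by rewrite awgn_gE; exact: measurable_gauss.
Qed.

Let integral_piece E x i :
  (\int[leb]_t (piece E x i t)%:E = (if i \in E then 1 - delta else delta)%:E)%E.
Proof.
rewrite /piece; case: (i \in E) => //.
have mg : measurable_fun setT (awgn_g lambda (x 0 i)).
  by rewrite awgn_gE; exact: measurable_gauss.
(* The mass of the residual follows from additivity; the total 1 also rules out an infinite
   value. *)
have : (\int[leb]_t ((awgn_g lambda (x 0 i) t - h t)%:E + (h t)%:E) = 1)%E.
  by under eq_integral do rewrite -EFinD subrK; rewrite awgn_gE integral_gauss.
rewrite ge0_integralD//=; first last.
- exact/measurable_EFinP.
- by move=> t _; rewrite lee_fin.
- by apply/measurable_EFinP; exact: measurable_funB.
- by move=> t _; rewrite lee_fin subr_ge0.
rewrite ih; case: (integral _ _ _) => [r| |]//=.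
by rewrite -EFinD => -[] r1; congr EFin; lra.
Qed.

(** The bound common to all messages: only separating [E] are kept, and by [sum_dual_coset] a single
    coset has the share [1 / #|C|] of the sum over all words. *)
Let ell z := (2 ^+ n)^-1 * #|C|%:R^-1 *
  \sum_(E | separates C E) \sum_x \prod_(i < n) piece E x i (z i).

Let ell_ge0 z : 0 <= ell z.
Proof.
rewrite !mulr_ge0 ?invr_ge0 ?exprn_ge0//.
by apply: sumr_ge0 => E _; apply: sumr_ge0 => x _; exact: prodr_ge0.
Qed.

Let ell_le_joint w z : w \in cosets C0 D -> ell z <= joint_wz lambda C0 D w z.
Proof.
case/imsetP => u _ ->; rewrite joint_wzE /ell -mulrA ler_wpM2l ?invr_ge0 ?exprn_ge0//.
(* Distributing the product of the sums [h + (g_b - h)] gives one term per set [E]. *)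
have -> : \sum_(d in D) pw (u + d) z =
    \sum_E \sum_(d in D) \prod_(i < n) piece E (u + d) i (z i).
  rewrite exchange_big/=; apply: eq_bigr => d _.
  under eq_bigr do rewrite /piece.
  by rewrite -bigA_distr; apply: eq_bigr => i _ /=; rewrite [RHS]addrC subrK.
(* The terms of non-separating [E] are nonnegative and dropped. *)
rewrite [leRHS](bigID (separates C))/= mulr_sumr ler_wpDr//.
  by apply: sumr_ge0 => E _; apply: sumr_ge0 => x _; exact: prodr_ge0.
apply: ler_sum => E sE.
rewrite -(sum_dual_coset u lC sE (phi := fun x => \prod_i piece E x i (z i))).
  by rewrite mulKf// pnatr_eq0 -lt0n linear_code_card_gt0.
move=> x y xy; apply: eq_bigr => i _; rewrite /piece.
by case: ifPn => // iE; rewrite xy.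
Qed.

(** [entropy_ge] with [c := ell z] holds at every [z]; the integral of the resulting sum of products
    is explicit. *)
Lemma equivocation_ge :
  ((log2 #|C|%:R * separating_prob delta C)%:E <= equivocation lambda C0 D)%E.
Proof.
have M0 : (#|C|%:R : R) != 0 by rewrite pnatr_eq0 -lt0n linear_code_card_gt0.
have l0 : 0 <= log2 #|C|%:R :> R by rewrite log2_ge0// ler1n linear_code_card_gt0.
(* Pairs [(E, x)] flatten the double sum in [ell] into the form required by [intRn_sum_prod]. *)
pose a (j : {set 'I_n} * bword n) : R :=
  if separates C j.1 then (2 ^+ n)^-1 * log2 #|C|%:R else 0.
have a0 j : 0 <= a j.
  by rewrite /a; case: ifP => // _; rewrite mulr_ge0// invr_ge0 exprn_ge0.
pose c (j : {set 'I_n} * bword n) (i : 'I_n) : R :=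
  if i \in j.1 then 1 - delta else delta.
(* The masses do not depend on the word, so the [2 ^ n] words cancel the factor [(2 ^+ n)^-1]. *)
have <- : \sum_j a j * \prod_(i < n) c j i = log2 #|C|%:R * separating_prob delta C.
  rewrite -(pair_bigA _ (fun E x => a (E, x) * \prod_(i < n) c (E, x) i))/=.
  rewrite /separating_prob mulr_sumr [RHS]big_mkcond/=; apply: eq_bigr => E _.
  rewrite /a /c /= sumr_const card_mx card_Fp// mul1n -[LHS]mulr_natr natrX.
  case: ifP => _; last by rewrite !mul0r.
  by rewrite mulrAC [X in X * _]mulrAC mulVf ?mul1r// expf_neq0// pnatr_eq0.
rewrite -(intRn_sum_prod (F := fun j => piece j.1 j.2) a0)//; last first.
  by move=> j i; rewrite integral_piece.
apply: le_intRn => z; rewrite lee_fin.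
  by apply: sumr_ge0 => j _; rewrite mulr_ge0// prodr_ge0.
apply: le_trans (entropy_ge (fun w => joint_wz_gt0 z (w := w)) card_cosets_gt0
  (ell_ge0 z) (fun w => @ell_le_joint w z)).
rewrite card_cosets_dual// /ell.
rewrite -(pair_bigA _ (fun E x => a (E, x) * \prod_(i < n) piece E x i (z i)))/=.
rewrite [X in _ <= X * _]mulrA [X in _ <= X * _ * _]mulrCA divff// mulr1.
rewrite [leRHS]mulrAC mulr_sumr.
rewrite [leRHS]big_mkcond/=; apply: ler_sum => E _; rewrite /a /=.
case: ifP => _; first by rewrite mulr_sumr.
by rewrite big1// => x _; rewrite mul0r.
Qed.

End LowerBound.

End Equivocation.

(** * Rates and passage to the limit *)

Lemma log2_expn (R : realType) (k : nat) : log2 ((2 ^ k)%N%:R : R) = k%:R.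
Proof.
by rewrite /log2 natrX lnXn// -[X in X / _]mulr_natl mulfK// gt_eqF// ln_gt0// ltr1n.
Qed.

Section Squeeze.
Local Open Scope classical_set_scope.

Lemma squeeze_loss (R : realType) (r : R) (e : nat -> R) (u : nat -> \bar R) :
  e @ \oo --> (0 : R) ->
  (forall m, (r * (1 - 2 * e m))%:E <= u m <= r%:E)%E -> u @ \oo --> r%:E.
Proof.
move=> e0 hu; apply: (@squeeze_cvge _ _ _ _ (fun m => (r * (1 - 2 * e m))%:E)
    _ (fun=> r%:E)); last exact: cvg_cst.
  by apply: nearW => m; exact: hu.
have {2}-> : r = r * (1 - 2 * 0) by rewrite mulr0 subr0 mulr1.
apply: cvg_EFin; first exact: nearW.
by apply: cvgMr; apply: cvgB; [exact: cvg_cst|exact: cvgMr].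
Qed.

End Squeeze.

Theorem theorem2 (R : realType) (lambda : R) (N : nat -> nat)
    (C : forall m, {set bword (N m)}) (Rc dstar : R) :
  0 < lambda ->
  linear_code_seq C Rc ->
  good_code_seq C Rc ->
  erasure_threshold C dstar ->
  (((1 - dstar) / 2)%:E <= Qfun (Num.sqrt (2 * lambda)))%E ->
  nested_achieves lambda (fun m => [set: bword (N m)])
                         (fun m => dual_code (C m)) Rc Rc.
Proof.
move=> l0 [_ [k Ck]] _ [d01 dC _] hQ.
have eta0 : 0 <= 1 - dstar by rewrite subr_ge0; case/andP: d01.
(* With mass [1 - dstar], a position lies in [E] as often as it is unerased at erasure probability
   [dstar]. *)
have [h [mh h0 hg ih]] := minorant_of_overlap (sqrtr_ge0 (2 * lambda)) eta0 hQ.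
have hgb b t : h t <= awgn_g lambda b t.
  by rewrite awgn_gE hg//; case: ifP; rewrite ?normrN ger0_norm ?sqrtr_ge0.
have rate m : log2 (#|C m|%:R : R) / (N m)%:R = Rc.
  by have [_ -> <-] := Ck m; rewrite log2_expn.
have lC m : linear_code (C m) by have [] := Ck m.
split=> [m||].
- by rewrite card_cosets_dual.
- under eq_fun do rewrite legit_error_full ?dual_code_linear//.
  exact: cvg_cst.
exists Rc%:E; split=> //.
(* The loss is governed by the word error at erasure probability [dstar] itself, which vanishes by
   [dC]. *)
apply: (squeeze_loss dC) => m; apply/andP; split.
  rewrite -(rate m) mulrAC EFinM lee_wpmul2r ?lee_fin ?invr_ge0//.
  apply: le_trans _ (equivocation_ge (lC m) h0 mh hgb ih).
  rewrite lee_fin ler_wpM2l ?separating_prob_ge//.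
  by rewrite log2_ge0// ler1n linear_code_card_gt0.
rewrite -(rate m) EFinM lee_wpmul2r ?lee_fin ?invr_ge0//.
exact: equivocation_le.
Qed.
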